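(* Let $L$ be a semilattice that embeds (as a semilattice) into a free semilattice. Then $L$ has the Noetherian property for consistent systems (NPC): every consistent system of $L$-equations in finitely many variables is equivalent over $L$ to some finite subsystem of itself.
   Context: A semilattice is a commutative idempotent semigroup. The free semilattice with free generators $\{a_i\mid i\in I\}$ consists of all finite nonempty products of distinct generators (equivalently, finite nonempty subsets of $I$ under union). For a finite set of variables $X=\{x_1,\dots,x_n\}$ let $F(X)$ be the free semilattice on $X$. For a semilattice $L$, an $L$-term is an element of the free product of semilattices $L\ast F(X)$, i.e. an expression $w(X)a$, $w(X)$ or $a$ with $w(X)\in F(X)$, $a\in L$. An $L$-equation is a formal equality of two $L$-terms. A system is an arbitrary (possibly infinite) set of $L$-equations in a fixed finite set of variables; its solution set in $L^n$ is the intersection of the solution sets of its equations. A system is consistent (over $L$) if its solution set is nonempty. Two systems are equivalent over $L$ if they have the same solution set in $L^n$. *)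

(* Defs.v *)
From HB Require Import structures.
From mathcomp Require Import all_boot finmap.
From mathcomp Require Import mathcomp_extra boolp classical_sets functions.
From mathcomp Require Import cardinality.

Set Implicit Arguments.
Unset Strict Implicit.
Unset Printing Implicit Defensive.

Import Algebra.

Local Open Scope group_scope.

HB.mixin Record Semigroup_isSemilattice L of Semigroup L := {
  smulgC : commutative (@mul L);
  smulgg : idempotent_op (@mul L)
}.

#[short(type="semilatticeType")]
HB.structure Definition Semilattice :=
  {L of Semigroup_isSemilattice L & Semigroup L}.

Section FreeSemilattice.
Variable I : choiceType.
Local Open Scope fset_scope.

Record free_semilattice := FreeSemilattice {
  fsl_support :> {fset I};
  fsl_support_neq0 : fsl_support != fset0
}.

HB.instance Definition _ := [isSub for fsl_support].
HB.instance Definition _ := [Choice of free_semilattice by <:].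

Lemma fsl_mul_subproof (A B : free_semilattice) :
  fsl_support A `|` fsl_support B != fset0.
Proof.
case/fset0Pn: (fsl_support_neq0 A) => i iA.
by apply/fset0Pn; exists i; rewrite inE iA.
Qed.

Definition fsl_mul (A B : free_semilattice) : free_semilattice :=
  FreeSemilattice (fsl_mul_subproof A B).

Lemma fsl_mulA : associative fsl_mul.
Proof. by move=> A B C; apply/val_inj; rewrite /= fsetUA. Qed.
Lemma fsl_mulC : commutative fsl_mul.
Proof. by move=> A B; apply/val_inj; rewrite /= fsetUC. Qed.
Lemma fsl_mulAA : idempotent_op fsl_mul.
Proof. by move=> A; apply/val_inj; rewrite /= fsetUid. Qed.

HB.instance Definition _ := isSemigroup.Build free_semilattice fsl_mulA.
HB.instance Definition _ :=
  Semigroup_isSemilattice.Build free_semilattice fsl_mulC fsl_mulAA.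

Lemma fsl_gen_subproof (i : I) : [fset i] != fset0.
Proof. by apply/fset0Pn; exists i; rewrite inE. Qed.

Definition fsl_gen (i : I) : free_semilattice :=
  FreeSemilattice (fsl_gen_subproof i).

End FreeSemilattice.

HB.instance Definition _ (L : semilatticeType) :=
  SemiGroup.isComLaw.Build L (@mul L) mulgA smulgC.

Section FreeExtension.
Variables (I : choiceType) (L : semilatticeType) (f : I -> L).

(* The product of the f i for i in A. There may be no neutral element in L,  *)
(* so the iteration starts from one of its factors, absorbed by idempotence. *)
Definition fsl_ext (A : free_semilattice I) : L :=
  \big[mul/f (xchoose (fset0Pn _ (fsl_support_neq0 A)))]_(i <- fsl_support A)
    f i.

Lemma big_mulgl (s : seq I) y z :
  y * \big[mul/z]_(i <- s) f i = \big[mul/y * z]_(i <- s) f i.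
Proof.
elim: s => [|i s IHs]; first by rewrite !big_nil.
by rewrite !big_cons -IHs !mulgA [f i * y]smulgC.
Qed.

Lemma big_absorb (s : seq I) i z :
  i \in s -> \big[mul/f i * z]_(j <- s) f j = \big[mul/z]_(j <- s) f j.
Proof.
elim: s => //= j s IHs; rewrite inE !big_cons => /predU1P[<-|/IHs-> //].
by rewrite -big_mulgl mulgA smulgg.
Qed.

Lemma fsl_extE (A : free_semilattice I) (i0 : I) :
  i0 \in fsl_support A -> fsl_ext A = \big[mul/f i0]_(i <- fsl_support A) f i.
Proof.
move=> Ai0; rewrite /fsl_ext.
set i1 := xchoose _; have Ai1 : i1 \in fsl_support A by apply: xchooseP.
by rewrite -(big_absorb (f i1) Ai0) smulgC big_absorb.
Qed.

Lemma fsl_ext_gen i : fsl_ext (fsl_gen i) = f i.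
Proof.
have /fsl_extE-> : i \in fsl_support (fsl_gen i) by rewrite inE.
have eq_s : perm_eq (fsl_support (fsl_gen i)) [:: i].
  by apply: uniq_perm => [||j]; rewrite ?fset_uniq ?inE.
by rewrite (perm_big _ eq_s) big_seq1_id; apply: smulgg.
Qed.

Lemma fsl_extM : {morph fsl_ext : A B / A * B}.
Proof.
move=> A B; have /fset0Pn[i Ai] := fsl_support_neq0 A.
have /fset0Pn[j Bj] := fsl_support_neq0 B.
have /fsl_extE-> : i \in fsl_support (A * B) by rewrite inE Ai.
rewrite (fsl_extE Ai) (fsl_extE Bj).
have eq_s : perm_eq (fsl_support (A * B))
    (undup (fsl_support A ++ fsl_support B)).
  by apply: uniq_perm; rewrite ?undup_uniq // => k; rewrite mem_undup mem_cat inE.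
rewrite (perm_big _ eq_s) big_undup; last exact: smulgg.
rewrite big_cat_idem /=; last exact: smulgg.
set a := \big[mul/f i]_(k <- fsl_support A) f k.
have -> : a = a * f i by rewrite /a [RHS]smulgC big_mulgl smulgg.
rewrite -!mulgA; congr (_ * _).
by rewrite !big_mulgl smulgg smulgC big_absorb.
Qed.

HB.instance Definition _ :=
  isMultiplicative.Build (free_semilattice I) L fsl_ext fsl_extM.

End FreeExtension.

(* In a product of elements of M and N, commutativity and idempotence let    *)
(* one gather the factors into at most one from each side; these normal      *)
(* forms are the elements of the free product.                               *)
Inductive free_product (M N : Type) :=
  | FPl of M
  | FPr of N
  | FPlr of M & N.

Section FreeProduct.
Variables M N : semilatticeType.

Definition fp_encode (t : free_product M N) : (M + N) + M * N :=
  match t with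
  | FPl a => inl (inl a)
  | FPr b => inl (inr b)
  | FPlr a b => inr (a, b)
  end.

Definition fp_decode (t : (M + N) + M * N) : free_product M N :=
  match t with
  | inl (inl a) => FPl N a
  | inl (inr b) => FPr M b
  | inr (a, b) => FPlr a b
  end.

Lemma fp_encodeK : cancel fp_encode fp_decode. Proof. by case. Qed.

HB.instance Definition _ :=
  Choice.copy (free_product M N) (can_type fp_encodeK).

Definition fp_mul (t u : free_product M N) : free_product M N :=
  match t, u with
  | FPl a, FPl a' => FPl N (a * a')
  | FPl a, FPr b' => FPlr a b'
  | FPl a, FPlr a' b' => FPlr (a * a') b'
  | FPr b, FPl a' => FPlr a' b
  | FPr b, FPr b' => FPr M (b * b')
  | FPr b, FPlr a' b' => FPlr a' (b * b')
  | FPlr a b, FPl a' => FPlr (a * a') b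
  | FPlr a b, FPr b' => FPlr a (b * b')
  | FPlr a b, FPlr a' b' => FPlr (a * a') (b * b')
  end.

Lemma fp_mulA : associative fp_mul.
Proof. by case=> [a|b|a b] [a'|b'|a' b'] [c|d|c d] //=; rewrite ?mulgA. Qed.

Lemma fp_mulC : commutative fp_mul.
Proof.
by case=> [a|b|a b] [a'|b'|a' b'] //=; rewrite ?[a * _]smulgC ?[b * _]smulgC.
Qed.

Lemma fp_mulgg : idempotent_op fp_mul.
Proof. by case=> [a|b|a b] /=; rewrite !smulgg. Qed.

HB.instance Definition _ := isSemigroup.Build (free_product M N) fp_mulA.
HB.instance Definition _ :=
  Semigroup_isSemilattice.Build (free_product M N) fp_mulC fp_mulgg.

Variables (L : semilatticeType) (f : M -> L) (g : N -> L).

Definition fp_ext (t : free_product M N) : L :=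
  match t with
  | FPl a => f a
  | FPr b => g b
  | FPlr a b => f a * g b
  end.

End FreeProduct.

Section FreeProductExtension.
Variables (M N L : semilatticeType).
Variables (f : {multiplicative M -> L}) (g : {multiplicative N -> L}).

Lemma fp_extM : {morph fp_ext f g : t u / t * u}.
Proof.
have mulgCA (x y z : L) : x * (y * z) = y * (x * z).
  by rewrite !mulgA [x * y]smulgC.
case=> [a|b|a b] [a'|b'|a' b'] //=; rewrite ?gmulfM -?mulgA //.
- exact: smulgC.
- by congr (_ * _); apply: smulgC.
- by congr (_ * _); apply: mulgCA.
Qed.

HB.instance Definition _ :=
  isMultiplicative.Build (free_product M N) L (fp_ext f g) fp_extM.

End FreeProductExtension.

Section Equations.
Variables (L : semilatticeType) (n : nat).

Definition lterm := free_product (free_semilattice 'I_n) L.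

(* The value at p: the extension of x_i |-> p_i that is the identity on L.   *)
Definition lterm_eval (p : {ffun 'I_n -> L}) : lterm -> L :=
  fp_ext (fsl_ext p) idfun.

Lemma lterm_evalM (p : {ffun 'I_n -> L}) :
  {morph lterm_eval p : t u / t * u}.
Proof. exact: fp_extM (fsl_ext p : {multiplicative _ -> L}) _. Qed.

Lemma lterm_eval_var (p : {ffun 'I_n -> L}) i :
  lterm_eval p (FPl L (fsl_gen i)) = p i.
Proof. exact: fsl_ext_gen. Qed.

Lemma lterm_eval_const (p : {ffun 'I_n -> L}) a : lterm_eval p (FPr _ a) = a.
Proof. by []. Qed.

Definition lequation := (lterm * lterm)%type.

Definition lsystem := set lequation.

Local Open Scope classical_set_scope.

Definition eq_solutions (e : lequation) : set {ffun 'I_n -> L} :=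
  [set p | lterm_eval p e.1 = lterm_eval p e.2].

Definition solutions (S : lsystem) : set {ffun 'I_n -> L} :=
  \bigcap_(e in S) eq_solutions e.

Definition consistent (S : lsystem) := solutions S !=set0.

Definition equivalent (S T : lsystem) := solutions S = solutions T.

End Equations.

Definition NPC (L : semilatticeType) := forall (n : nat) (S : lsystem L n),
  consistent S ->
  exists S0 : lsystem L n,
    [/\ (S0 `<=` S)%classic, finite_set S0 & equivalent S S0].

(* Main.v *)
Require Import Defs.
From HB Require Import structures.
From mathcomp Require Import all_boot finmap.
From mathcomp Require Import mathcomp_extra boolp classical_sets functions.
From mathcomp Require Import cardinality.

(** View [L] inside the finite nonempty subsets of [I] under union. The value
    of a term [w(X)a] at [p] is then the union of the [f (p k)], for [x_k] a
    variable of [w], and of the set [f a]; whether an equation holds can thus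
    be decided one generator [i] at a time, and at [i] the equation only says
    something that depends on finitely many bits of it: its variables on each
    side, and whether [i] lies in the constant of each side. When [i] lies in
    both constants it says nothing at all.

    Let [p] be a solution of the system [S], and let [P] be the finite union of
    the [f (p k)]. Since [p] is a solution, the two constants of any equation of
    [S] agree outside [P]. Choose finitely many equations [S1] of [S] showing
    all the pairs of variable sets that occur in [S], and let [Q] be the finite
    union of [P] and of the left constants of [S1]. Outside [Q], an equation of [S]
    either has [i] in both constants or says the same thing as the equation of
    [S1] with the same variables, which has [i] in none. Inside [Q], there are
    only finitely many possible traces of the constants, so finitely many
    equations [S2] of [S] say everything that [S] says there. The union of [S1]
    and [S2] is the required finite subsystem. *)

Local Open Scope fset_scope.

(** A map with finitely many values on [S] takes them all on a finite part of
    [S]: this is how finite subsystems are extracted. *)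
Lemma finite_image_representatives (T : choiceType) (K : Type) (h : T -> K)
    (S : set T) :
  finite_set (h @` S)%classic ->
  exists s : seq T, (forall x, x \in s -> S x) /\
    (forall x, S x -> exists2 y, y \in s & h y = h x).
Proof.
move=> finhS; have [[x0 Sx0]|S0] := pselect (exists x, S x); last first.
  by exists [::]; split=> // x Sx; case: S0; exists x.
have /choice[g gP] v : exists y, S y /\ ((h @` S)%classic v -> h y = v).
  case: (pselect ((h @` S)%classic v)) => [[y Sy yv]|nhSv]; first by exists y.
  by exists x0.
have /finite_seqP[s eq_s] := finite_image g finhS.
have s_g y : (y \in s) = (g @` (h @` S))%classic y :> Prop by rewrite eq_s.
exists s; split=> [y | x Sx]; first by rewrite s_g => -[v _ <-]; apply: (gP v).1.
exists (g (h x)); first by rewrite s_g; exists (h x) => //; exists x.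
by apply: (gP _).2; exists x.
Qed.

Section Traces.
Set Implicit Arguments.
Unset Strict Implicit.
Variables (L : semilatticeType) (I : choiceType).
Variables (f : {multiplicative L -> free_semilattice I}) (n : nat).
Implicit Types (t : lterm L n) (p : {ffun 'I_n -> L}).

(** An absent factor of a term is read as the empty set, the unit of union, so
    that the three shapes of terms need no separate treatment below. *)
Definition variables t : {fset 'I_n} :=
  match t with
  | FPl w => w
  | FPr _ => fset0
  | FPlr w _ => w
  end.

Definition constant_support t : {fset I} :=
  match t with
  | FPl _ => fset0
  | FPr a => f a
  | FPlr _ a => f a
  end.

Lemma in_image_big p (s : seq 'I_n) z i :
  (i \in fsl_support (f (\big[mul/z]_(k <- s) p k)%g)) =
  has (fun k => i \in fsl_support (f (p k))) s || (i \in fsl_support (f z)).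
Proof.
elim: s => [|k s IHs]; first by rewrite big_nil.
by rewrite big_cons gmulfM in_fsetU IHs /= orbA.
Qed.

Lemma in_image_fsl_ext p (w : free_semilattice 'I_n) i :
  (i \in fsl_support (f (fsl_ext p w))) =
  has (fun k => i \in fsl_support (f (p k))) (fsl_support w).
Proof.
have /fset0Pn[k wk] := fsl_support_neq0 w.
rewrite (fsl_extE p wk) in_image_big orb_idr // => fpk.
by apply/hasP; exists k.
Qed.

(** Once [p] is known, only the variables of [t] and the membership of [i] in
    its constant matter at [i]: equations with the same variables whose
    constants agree at [i] constrain the unknowns identically there. *)
Lemma in_image_lterm_eval p t i :
  (i \in fsl_support (f (lterm_eval p t))) =
  has (fun k => i \in fsl_support (f (p k))) (variables t)
  || (i \in constant_support t).
Proof.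
case: t => [w|a|w a]; rewrite /lterm_eval /=.
- by rewrite in_image_fsl_ext in_fset0 orbF.
- by [].
- by rewrite gmulfM in_fsetU in_image_fsl_ext.
Qed.

Definition value_support p : {fset I} :=
  (\bigcup_(k <- enum 'I_n) fsl_support (f (p k)))%fset.

Lemma in_image_lterm_eval_outside p t i : i \notin value_support p ->
  (i \in fsl_support (f (lterm_eval p t))) = (i \in constant_support t).
Proof.
move=> niP; rewrite in_image_lterm_eval; case: hasP => // -[k _ fpk].
by case/bigfcupP: niP; exists k; rewrite ?mem_enum.
Qed.

(** Outside the values of the unknowns, both sides of an equation reduce to
    their constants. Consistency enters the theorem only through this fact,
    applied to a solution [p] of the whole system. *)
Lemma constant_support_eq_outside p (e : lequation L n) i :
  eq_solutions e p -> i \notin value_support p ->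
  (i \in constant_support e.1) = (i \in constant_support e.2).
Proof. by move=> pe niP; rewrite -!(in_image_lterm_eval_outside _ niP) pe. Qed.

End Traces.

Theorem corollary3p4 (L : semilatticeType) (I : choiceType)
  (f : {multiplicative L -> free_semilattice I}) (f_inj : injective f) :
  NPC L.
Proof.
move=> n S [p pS].
pose vars (e : lequation L n) := (variables e.1, variables e.2).
have [|s1 [s1S s1P]] := @finite_image_representatives _ _ vars S.
  exact: finite_finset.
pose Q := (value_support f p `|` \bigcup_(e <- s1) constant_support f e.1)%fset.
(* Subsets of [Q] are finitely many, so [trace] has finitely many values. *)
pose trace (e : lequation L n) :=
  (vars e, (constant_support f e.1 `&` Q, constant_support f e.2 `&` Q)).
have [|s2 [s2S s2P]] := @finite_image_representatives _ _ trace S.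
  apply: (@sub_finite_set _ _
    ([set: _] `*` ([set` fpowerset Q] `*` [set` fpowerset Q]))%classic).
    by move=> _ [e _ <-]; split=> //; split; rewrite /= fpowersetE fsubsetIr.
  by apply: finite_setX; [exact: finite_finset | exact: finite_setX].
exists [set` s1 ++ s2]%classic; split.
- by move=> e /=; rewrite mem_cat => /orP[/s1S|/s2S].
- exact: finite_seq.
rewrite /equivalent eqEsubset; split=> q qS e.
  by rewrite /= mem_cat => /orP[/s1S|/s2S]; apply: qS.
have {}qS d : d \in s1 ++ s2 -> eq_solutions d q by move=> ds; apply: qS.
move=> Se; apply: f_inj; apply/val_inj/fsetP => i /=.
rewrite !in_image_lterm_eval; have [iQ|niQ] := boolP (i \in Q).
  have [d ds2 [v1 v2 c1 c2]] := s2P e Se.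
  have cst (t u : lterm L n) :
      constant_support f t `&` Q = constant_support f u `&` Q ->
      (i \in constant_support f u) = (i \in constant_support f t).
    by move/fsetP/(_ i); rewrite !in_fsetI iQ !andbT.
  rewrite -v1 -v2 (cst _ _ c1) (cst _ _ c2) -!in_image_lterm_eval.
  by rewrite qS // mem_cat ds2 orbT.
have niP : i \notin value_support f p.
  by apply: contra niQ; rewrite in_fsetU => ->.
have cst d : S d ->
    (i \in constant_support f d.1) = (i \in constant_support f d.2).
  by move=> Sd; apply: constant_support_eq_outside niP; apply: pS.
rewrite -(cst e Se); have [_|nie] := boolP (i \in constant_support f e.1).
  by rewrite !orbT.
(* The left constant of [d] lies in [Q], so it misses [i]; then so does the
   right one, as [i] is not in [P]. The constants of [e] miss [i] as well. *)
have [d ds1 [v1 v2]] := s1P e Se.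
have nid : i \notin constant_support f d.1.
  apply: contra niQ => id; rewrite in_fsetU; apply/orP; right.
  by apply/bigfcupP; exists d; rewrite ?ds1.
have : eq_solutions d q by apply: qS; rewrite mem_cat ds1.
move/(congr1 (fun x => i \in fsl_support (f x))).
by rewrite !in_image_lterm_eval -(cst d (s1S d ds1)) (negPf nid) v1 v2.
Qed.
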